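(* Let $D$ be a division ring, and let $R=\prod_{i\in I}\mathrm{End}_D(V_i)$ be the direct product of the endomorphism rings of a family $(V_i)_{i\in I}$ of finite-dimensional $D$-vector-spaces (i.e., a direct product of full matrix rings of various sizes over $D$). Then every element of $R$ has a strong inner inverse in $R$ under multiplication.
   Context: For elements $x,y$ of a monoid $M$, $y$ is called a strong inner inverse to $x$ (in $M$) if $x^i y^j x^k = y^{j-i}x^j y^{j-k}$ for all integers $i,j,k$ with $0\le i\le j$ and $0\le k\le j$. For a ring $R$, the multiplicative monoid of $R$ is meant. *)

(* Defs.v *)
From HB Require Import structures.
From mathcomp Require Import all_boot all_order all_algebra.
From mathcomp Require Import boolp.

Set Implicit Arguments.
Unset Strict Implicit.
Unset Printing Implicit Defensive.

Import GRing.Theory.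

Section StrongInnerInverse.
Local Open Scope group_scope.

Definition strong_inner_inverse (M : monoidType) (x y : M) : Prop :=
  forall i j k : nat, (i <= j)%N -> (k <= j)%N ->
    x ^+ i * y ^+ j * x ^+ k = y ^+ (j - i)%N * x ^+ j * y ^+ (j - k)%N.

End StrongInnerInverse.

Local Open Scope ring_scope.

(* A ring R of the algebraic hierarchy has no canonical monoidType structure;
   the alias mul_monoid R carries its multiplicative one. *)
Definition mul_monoid (R : pzRingType) : Type := R.

HB.instance Definition _ (R : pzRingType) := Choice.on (mul_monoid R).
HB.instance Definition _ (R : pzRingType) :=
  isMonoid.Build (mul_monoid R) (@mulrA R) (@mul1r R) (@mulr1 R).

(* MathComp has no type of possibly noncommutative division rings. Since a
   unitRingType is nonzero, it suffices that nonzero elements be units. *)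
Definition division_ring (D : unitRingType) : Prop :=
  forall a : D, a != 0 -> a \is a GRing.unit.

(* The library makes 'End(V) a ring only over a commutative base ring and for
   V of positive dimension. Neither restriction is imposed here, hence an alias
   and a pzRingType, which allows 1 = 0. The product is composition of maps:
   (f * g) v = f (g v). *)
Definition End_ring (R : nzRingType) (V : vectType R) : Type := 'End(V).

Section EndRing.
Variables (R : nzRingType) (V : vectType R).

HB.instance Definition _ := GRing.Zmodule.on (End_ring V).
HB.instance Definition _ := GRing.Zmodule_isPzRing.Build (End_ring V)
  (@comp_lfunA R V V V V) (@comp_lfun1l R V V) (@comp_lfun1r R V V)
  (@comp_lfunDl R V V V) (@comp_lfunDr R V V V).

End EndRing.

Definition prod_ring (I : Type) (R : I -> pzRingType) : Type :=
  forall i : I, R i.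

Section ProdRing.
Variables (I : Type) (R : I -> pzRingType).

HB.instance Definition _ := gen_eqMixin (prod_ring R).
HB.instance Definition _ := gen_choiceMixin (prod_ring R).

Implicit Types f g h : prod_ring R.

Definition prod_ring_zero : prod_ring R := fun=> 0.
Definition prod_ring_one : prod_ring R := fun=> 1.
Definition prod_ring_opp f : prod_ring R := fun i => - f i.
Definition prod_ring_add f g : prod_ring R := fun i => f i + g i.
Definition prod_ring_mul f g : prod_ring R := fun i => f i * g i.

Fact prod_ring_addA : associative prod_ring_add.
Proof. by move=> f g h; apply: functional_extensionality_dep => i; exact: addrA. Qed.

Fact prod_ring_addC : commutative prod_ring_add.
Proof. by move=> f g; apply: functional_extensionality_dep => i; exact: addrC. Qed.

Fact prod_ring_add0r : left_id prod_ring_zero prod_ring_add.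
Proof. by move=> f; apply: functional_extensionality_dep => i; exact: add0r. Qed.

Fact prod_ring_addNr : left_inverse prod_ring_zero prod_ring_opp prod_ring_add.
Proof. by move=> f; apply: functional_extensionality_dep => i; exact: addNr. Qed.

Fact prod_ring_mulA : associative prod_ring_mul.
Proof. by move=> f g h; apply: functional_extensionality_dep => i; exact: mulrA. Qed.

Fact prod_ring_mul1r : left_id prod_ring_one prod_ring_mul.
Proof. by move=> f; apply: functional_extensionality_dep => i; exact: mul1r. Qed.

Fact prod_ring_mulr1 : right_id prod_ring_one prod_ring_mul.
Proof. by move=> f; apply: functional_extensionality_dep => i; exact: mulr1. Qed.

Fact prod_ring_mulDl : left_distributive prod_ring_mul prod_ring_add.
Proof. by move=> f g h; apply: functional_extensionality_dep => i; exact: mulrDl. Qed.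

Fact prod_ring_mulDr : right_distributive prod_ring_mul prod_ring_add.
Proof. by move=> f g h; apply: functional_extensionality_dep => i; exact: mulrDr. Qed.

HB.instance Definition _ := GRing.isZmodule.Build (prod_ring R)
  prod_ring_addA prod_ring_addC prod_ring_add0r prod_ring_addNr.
HB.instance Definition _ := GRing.Zmodule_isPzRing.Build (prod_ring R)
  prod_ring_mulA prod_ring_mul1r prod_ring_mulr1 prod_ring_mulDl prod_ring_mulDr.

End ProdRing.

(* Main.v *)
Require Import Defs.
From mathcomp Require Import all_boot all_order all_algebra.
From mathcomp Require Import boolp.

(** Everything is reduced to a single square matrix x over a division ring D:
    the identities can be checked coordinatewise in a product, and the matrix
    of an endomorphism of V depends on it anti-multiplicatively, which is
    harmless since reading the defining identity backwards exchanges i and k.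

    A square matrix x over D of size n is either invertible, and then its
    inverse is a strong inner inverse, or it factors as x = c q through a
    smaller size r, with c left invertible and q right invertible
    ([unit_or_rank_factorization], by Gaussian elimination).  In the second
    case c identifies D^r with the image W of x, and u = q c is the matrix of
    the restriction of x to W.  By induction on the size, u has a strong inner
    inverse z, and it remains to extend z to the whole space.

    In terms of Jordan chains of a nilpotent x, z shifts every chain of W one
    step up and kills its top.  The extension y agrees with z except that it
    sends the top of each chain of W to a preimage of it under x, and it kills
    a complement of W that contains these new tops.  Without bases: y = s t, where s is a section of q that
    agrees with c z on the image of u, and t is a retraction onto W whose
    kernel contains the new tops and is such that u t = u z q.  Such s and t
    are made from an arbitrary section and retraction, using the idempotents
    1 - u z and 1 - z u ([strong_inner_inverse_induced]).  Then t s = z, so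
    that all mixed products of powers of x = c q and y = s t collapse to
    products of powers of u and z with every exponent lowered by one
    ([strong_inner_inverse_lift]).  When x is not nilpotent, iterated images
    stabilize at its invertible part, where the induction starts. *)

Set Implicit Arguments.
Unset Strict Implicit.
Unset Printing Implicit Defensive.

Import GRing.Theory VectorInternalTheory.

(** * Strong inner inverses in monoids and rings *)

(** The reverse of the (i, j, k) identity is the (k, j, i) identity, so the
    notion is invariant under anti-isomorphisms as well. *)
Lemma strong_inner_inverse_anti (M N : monoidType) (f : M -> N) :
    injective f -> f 1%g = 1%g -> (forall a b, f (a * b)%g = (f b * f a)%g) ->
  forall x y, strong_inner_inverse (f x) (f y) -> strong_inner_inverse x y.
Proof.
move=> f_inj f1 fM x y fxy i j k leij lekj; apply: f_inj.
have fX a n : f (a ^+ n)%g = (f a ^+ n)%g.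
  by elim: n => [|n IHn]; rewrite ?expg0 // expgS fM IHn expgSr.
by rewrite !fM !fX mulgA fxy // mulgA.
Qed.

Local Open Scope ring_scope.

Lemma mul_monoidX (R : pzRingType) (a : mul_monoid R) n :
  (a ^+ n)%g = (a : R) ^+ n.
Proof. by elim: n => // n IHn; rewrite expgS IHn exprS. Qed.

(** The three families are the cases i = k = j, k = 0 and i = 0 of the
    definition.  They imply the rest: for i, k <= j,
      x^i y^j x^k = y^(j-i) x^j (y^j x^k)
                  = y^(j-i) (x^j y^j x^j) y^(j-k) = y^(j-i) x^j y^(j-k).
    Writing j as i + m or k + m avoids truncated subtraction. *)
Lemma strong_inner_inverseP (R : pzRingType) (x y : R) :
  strong_inner_inverse (x : mul_monoid R) (y : mul_monoid R) <->
  [/\ forall j, x ^+ j * y ^+ j * x ^+ j = x ^+ j,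
      forall i m, x ^+ i * y ^+ (i + m) = y ^+ m * x ^+ (i + m) * y ^+ (i + m)
    & forall k m, y ^+ (k + m) * x ^+ k = y ^+ (k + m) * x ^+ (k + m) * y ^+ m].
Proof.
split=> [xy | [xyx xly yrx] i j k leij lekj]; last first.
  rewrite !mul_monoidX.
  change (x ^+ i * y ^+ j * x ^+ k = y ^+ (j - i) * x ^+ j * y ^+ (j - k)).
  have := xly i (j - i)%N; have := yrx k (j - k)%N; rewrite !subnKC // => yx ->.
  by rewrite -mulrA yx -!mulrA; congr (_ * _); rewrite !mulrA xyx.
have {}xy i j k : (i <= j)%N -> (k <= j)%N ->
    x ^+ i * y ^+ j * x ^+ k = y ^+ (j - i) * x ^+ j * y ^+ (j - k).
  by move=> leij lekj; have := xy i j k leij lekj; rewrite !mul_monoidX.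
split=> [j | i m | k m].
- by have := xy j j j; rewrite subnn expr0 mul1r mulr1; apply.
- have := xy i (i + m)%N 0 (leq_addr _ _) isT.
  by rewrite expr0 mulr1 addKn subn0.
- have := xy 0 (k + m)%N k isT (leq_addr _ _).
  by rewrite expr0 mul1r addKn subn0.
Qed.

Lemma strong_inner_inverse_unit (R : pzRingType) (x y : R) :
  x * y = 1 -> y * x = 1 ->
  strong_inner_inverse (x : mul_monoid R) (y : mul_monoid R).
Proof.
move=> xy1 yx1; have cxy : GRing.comm x y by rewrite /GRing.comm xy1.
have xyX j : x ^+ j * y ^+ j = 1 by rewrite -exprMn_comm // xy1 expr1n.
have yxX j : y ^+ j * x ^+ j = 1 by rewrite -exprMn_comm ?yx1 ?expr1n.
apply/strong_inner_inverseP; split=> [j | i m | k m].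
- by rewrite xyX mul1r.
- by rewrite -[RHS]mulrA xyX mulr1 exprD mulrA xyX mul1r.
- by rewrite yxX mul1r addnC exprD -mulrA yxX mulr1.
Qed.

(** * Extending a strong inner inverse from the image of a matrix *)

Lemma exprS_mulmx (R : pzRingType) n r (c : 'M[R]_(n, r)) (q : 'M[R]_(r, n)) j :
  (c *m q) ^+ j.+1 = c *m (q *m c) ^+ j *m q.
Proof.
elim: j => [|j IHj]; first by rewrite expr1 expr0 mulmx1.
by rewrite exprS IHj exprS -!mulmxE !mulmxA.
Qed.

(** A product x^(i+1) y^(j+1) is c u^i (q s) z^j t, with q s = 1, and similarly
    for y^(i+1) x^(j+1); so the identities for x and y are those for u = q c
    and z = t s with exponents lowered by one, surrounded by c or s on the
    left and by q or t on the right.  The last two equations say that s is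
    c z on the image of u, and that t is z q up to the kernel of u: they trade
    s for c and t for q when the two sides of an identity start or end
    differently. *)
Lemma strong_inner_inverse_lift (R : pzRingType) n r
    (c s : 'M[R]_(n, r)) (q t : 'M[R]_(r, n)) :
  t *m c = 1%:M -> q *m s = 1%:M ->
  s *m (q *m c) = c *m (t *m s) *m (q *m c) ->
  (q *m c) *m t = (q *m c) *m (t *m s) *m q ->
  strong_inner_inverse (q *m c : mul_monoid 'M[R]_r) (t *m s : mul_monoid 'M[R]_r) ->
  strong_inner_inverse (c *m q : mul_monoid 'M[R]_n) (s *m t : mul_monoid 'M[R]_n).
Proof.
move=> tc1 qs1 su ut /strong_inner_inverseP[uzu uz zu].
apply/strong_inner_inverseP; move: uzu uz zu su ut.
set u := q *m c; set z := t *m s; rewrite -!mulmxE => uzu uz zu su ut.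
have xX := exprS_mulmx c q; have yX := exprS_mulmx s t.
have xyE i j : (c *m q) ^+ i.+1 *m (s *m t) ^+ j.+1 = c *m (u ^+ i *m z ^+ j) *m t.
  by rewrite xX yX -!mulmxA (mulmxA q) qs1 mul1mx.
have yxE i j : (s *m t) ^+ i.+1 *m (c *m q) ^+ j.+1 = s *m (z ^+ i *m u ^+ j) *m q.
  by rewrite xX yX -!mulmxA (mulmxA t) tc1 mul1mx.
have suS i : s *m u ^+ i.+1 = c *m z *m u ^+ i.+1.
  by rewrite exprS -mulmxE !mulmxA -(mulmxA s) su !mulmxA.
have utS i : u ^+ i.+1 *m t = u ^+ i.+1 *m (z *m q).
  by rewrite exprSr -mulmxE -mulmxA ut !mulmxA.
(* In each family, the exponent 0 of x or y has to be treated apart, since only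
   positive powers of x = c q and y = s t factor through the smaller size. *)
split=> [[|j] | [|i] m | [|k] m].
- by rewrite !expr0 !mulmx1.
- rewrite xyE xX -!mulmxA (mulmxA t) tc1 mul1mx.
  by congr (_ *m _); rewrite !mulmxA uzu.
- case: m => [|m]; first by rewrite !expr0 !mulmx1.
  rewrite add0n expr0 mul1mx yxE yX -!mulmxA (mulmxA q) qs1 mul1mx.
  congr (_ *m _); rewrite !mulmxA; congr (_ *m _).
  by have := uz 0%N m; rewrite add0n expr0 mul1mx.
- case: m => [|m]; first by rewrite addn0 expr0 mul1mx.
  (* The identities for the exponents i and i.+1 of u, with the same power of
     z, bring the leading u that allows s to be replaced by c z. *)
  have key : c *m (u ^+ i *m z ^+ (i + m.+1)) =
      s *m (z ^+ m *m u ^+ (i + m.+1) *m z ^+ (i + m.+1)).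
    rewrite uz addnS -addSn -uz (mulmxA s) suS -!mulmxA uz.
    by rewrite (exprS z m) -mulmxE !mulmxA.
  rewrite addSn xyE yxE yX key -!mulmxA (mulmxA q) qs1 mul1mx.
  by rewrite !mulmxA.
- case: m => [|m]; first by rewrite !expr0 !mulmx1.
  rewrite add0n expr0 mulmx1 yxE yX -!mulmxA (mulmxA q) qs1 mul1mx.
  congr (_ *m _); rewrite !mulmxA; congr (_ *m _).
  by have := zu 0%N m; rewrite add0n expr0 mulmx1.
- case: m => [|m]; first by rewrite addn0 expr0 mulmx1.
  have key : z ^+ (k + m.+1) *m u ^+ k *m q =
      z ^+ (k + m.+1) *m u ^+ (k + m.+1) *m z ^+ m *m t.
    rewrite zu addnS -addSn -zu -(mulmxA _ _ t) utS !mulmxA zu.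
    by rewrite (exprSr z m) -mulmxE !mulmxA.
  rewrite addSn !yxE yX -(mulmxA s) key -!mulmxA (mulmxA q) qs1 mul1mx.
  by rewrite !mulmxA.
Qed.

(** Let u = q c.  The idempotent e = 1 - u z projects onto a complement of the
    image of u, and f = 1 - z u onto the kernel of u.  On the image of u the
    required section of q is forced to be c z, and on the image of e it may be
    any section s: hence c z + s e.  Dually, the retraction has to be z q modulo the
    image of f, and there any retraction of c may be used that vanishes on the
    image of s e, so that the new section and retraction compose to z. *)
Lemma strong_inner_inverse_induced (R : pzRingType) n r
    (c : 'M[R]_(n, r)) (q : 'M[R]_(r, n)) (s : 'M[R]_(n, r)) (t : 'M[R]_(r, n))
    (z : 'M[R]_r) :
  t *m c = 1%:M -> q *m s = 1%:M ->
  strong_inner_inverse (q *m c : mul_monoid 'M[R]_r) (z : mul_monoid 'M[R]_r) ->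
  exists y : 'M[R]_n,
    strong_inner_inverse (c *m q : mul_monoid 'M[R]_n) (y : mul_monoid 'M[R]_n).
Proof.
move=> tc1 qs1 uz; have /strong_inner_inverseP[uzu1 _ /(_ 0%N 1%N)] := uz.
have:= uzu1 1%N; rewrite !expr1 expr0 mulr1 -!mulmxE => {uzu1}.
set u := q *m c => uzu zuz.
pose e := 1%:M - u *m z; pose f := 1%:M - z *m u.
have eu : e *m u = 0 by rewrite mulmxBl mul1mx uzu subrr.
have uf : u *m f = 0 by rewrite mulmxBr mulmx1 mulmxA uzu subrr.
have ze : z *m e = 0 by rewrite mulmxBr mulmx1 mulmxA -zuz subrr.
have ee : e *m e = e by rewrite {1}/e mulmxBl mul1mx -mulmxA ze mulmx0 subr0.
pose s' := c *m z + s *m e.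
pose t' := z *m q + f *m (t - t *m s *m e *m q).
have t'c : t' *m c = 1%:M.
  have -> : t' *m c = z *m u + f *m (t *m c - t *m s *m (e *m u)).
    by rewrite /u mulmxDl -!mulmxA (mulmxBl t) -!mulmxA.
  by rewrite tc1 eu mulmx0 subr0 mulmx1 addrC subrK.
have qs' : q *m s' = 1%:M.
  by rewrite mulmxDr !mulmxA qs1 mul1mx addrC subrK.
(* This is where the correction term t s e q in t' is used. *)
have t's' : t' *m s' = z.
  have t's : t' *m s = z + f *m (t *m s - t *m s *m e).
    by rewrite mulmxDl -!mulmxA (mulmxBl t) -!mulmxA qs1 !mulmx1.
  rewrite mulmxDr !mulmxA t'c mul1mx t's mulmxDl ze add0r -[f *m _ *m e]mulmxA.
  by rewrite (mulmxBl (t *m s)) -(mulmxA _ e e) ee subrr mulmx0 addr0.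
exists (s' *m t'); apply: strong_inner_inverse_lift; rewrite // t's' //.
- by rewrite mulmxDl -!mulmxA eu mulmx0 addr0.
- by rewrite -/u mulmxDr (mulmxA u z) (mulmxA u f) uf mul0mx addr0.
Qed.

(** * Gaussian elimination over a division ring *)

Lemma tperm_mx_involutive (R : pzRingType) n (i j : 'I_n) :
  tperm_mx i j *m tperm_mx i j = 1%:M :> 'M[R]_n.
Proof. by rewrite -perm_mxM perm.tperm2 perm_mx1. Qed.

(** The inverse is part of the data, since determinants and adjugates make no
    sense over a noncommutative ring. *)
Definition mutually_inverse_mx (R : pzRingType) n (P P' : 'M[R]_n) : Prop :=
  P *m P' = 1%:M /\ P' *m P = 1%:M.

Lemma mutually_inverse_mxM (R : pzRingType) n (P P' Q Q' : 'M[R]_n) :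
  mutually_inverse_mx P P' -> mutually_inverse_mx Q Q' ->
  mutually_inverse_mx (P *m Q) (Q' *m P').
Proof.
move=> [PP' P'P] [QQ' Q'Q]; split.
  by rewrite -mulmxA (mulmxA Q) QQ' mul1mx.
by rewrite -mulmxA (mulmxA P') P'P mul1mx.
Qed.

Definition one_block_mx (R : pzRingType) m n (A : 'M[R]_(m, n)) :
  'M[R]_(1 + m, 1 + n) := block_mx 1%:M 0 0 A.

Lemma one_block_mxM (R : pzRingType) m n p (A : 'M[R]_(m, n)) (B : 'M[R]_(n, p)) :
  one_block_mx A *m one_block_mx B = one_block_mx (A *m B).
Proof.
by rewrite mulmx_block !(mul0mx, mulmx0, mul1mx, addr0, add0r).
Qed.

Lemma one_block_mx1 (R : pzRingType) n : one_block_mx 1%:M = 1%:M :> 'M[R]_(1 + n).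
Proof. by rewrite [RHS]scalar_mx_block. Qed.

(** One elimination step: a nonzero entry a is moved to the corner by two
    transpositions, and then
      [a, b; d, g] = [a, 0; d, 1] [1, 0; 0, g - d a^-1 b] [1, a^-1 b; 0, 1]. *)
Lemma division_ring_pivot (D : unitRingType) (hD : division_ring D) n
    (x : 'M[D]_(1 + n)) : x != 0 ->
  exists P P' Q Q' : 'M[D]_(1 + n), exists S : 'M[D]_n,
    [/\ mutually_inverse_mx P P', mutually_inverse_mx Q Q'
      & x = P *m one_block_mx S *m Q].
Proof.
case/matrix0Pn=> i [j nz_xij].
pose T k : 'M[D]_(1 + n) := tperm_mx k 0.
have TT k : mutually_inverse_mx (T k) (T k) by split; apply: tperm_mx_involutive.
pose x' : 'M[D]_(1 + n) := T i *m x *m T j.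
have xE : x = T i *m x' *m T j.
  rewrite /x' -!mulmxA (TT j).1 mulmx1 mulmxA.
  by rewrite (TT i).1 mul1mx.
pose ul : 'M[D]_1 := (x i j)%:M; pose ul' : 'M[D]_1 := (x i j)^-1%:M.
have ulul' : mutually_inverse_mx ul ul'.
  by split; rewrite -scalar_mxM ?mulrV ?mulVr ?hD.
have ulE : ulsubmx x' = ul.
  rewrite [LHS]mx11_scalar /x' /T -xrowE -xcolE !mxE !lshift0.
  by rewrite !perm.tpermR.
(* From here on only the corner entry of x' matters. *)
clearbody x'; set ur := ursubmx x'; set dl := dlsubmx x'.
pose S := drsubmx x' - dl *m ul' *m ur.
pose L := block_mx ul 0 dl 1%:M; pose L' := block_mx ul' 0 (- (dl *m ul')) 1%:M.
pose U := block_mx 1%:M (ul' *m ur) 0 1%:M.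
pose U' := block_mx 1%:M (- (ul' *m ur)) 0 1%:M.
have LL' : mutually_inverse_mx L L'.
  split; rewrite mulmx_block !(mul0mx, mulmx0, mulmx1, mul1mx, addr0, add0r).
    by rewrite ulul'.1 subrr -scalar_mx_block.
  by rewrite ulul'.2 mulNmx -mulmxA ulul'.2 mulmx1 addNr -scalar_mx_block.
have UU' : mutually_inverse_mx U U'.
  split; rewrite mulmx_block !(mul0mx, mulmx0, mulmx1, mul1mx, addr0, add0r).
    by rewrite addNr -scalar_mx_block.
  by rewrite subrr -scalar_mx_block.
exists (T i *m L), (L' *m T i), (U *m T j), (T j *m U'), S.
split; do ?exact: mutually_inverse_mxM.
rewrite xE -!mulmxA; congr (_ *m _); rewrite !mulmxA; congr (_ *m _).
rewrite -[x']submxK ulE !mulmx_block.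
rewrite !(mul0mx, mulmx0, mulmx1, mul1mx, addr0, add0r).
by rewrite !mulmxA ulul'.1 mul1mx addrC subrK.
Qed.

(** By induction on the size: the remainder S of an elimination step is either
    invertible or factors through a smaller size, and each alternative passes
    to diag(1, S) and then to x.  The dichotomy plays the part of the
    theorem that a square matrix of full rank is invertible. *)
Lemma unit_or_rank_factorization (D : unitRingType) (hD : division_ring D) n
    (x : 'M[D]_n) :
  (exists y, mutually_inverse_mx x y) \/
  (exists r, (r < n)%N /\
   exists (c s : 'M[D]_(n, r)) (q t : 'M[D]_(r, n)),
     [/\ x = c *m q, t *m c = 1%:M & q *m s = 1%:M]).
Proof.
elim: n x => [|n IHn] x.
  by left; exists 0; split; rewrite [LHS]flatmx0 [RHS]flatmx0.
change ('M[D]_(1 + n)) in x.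
have [-> | /(division_ring_pivot hD)] := eqVneq x 0.
  right; exists 0; split=> //; exists 0, 0, 0, 0.
  by split; rewrite ?mulmx0 // [LHS]flatmx0 [RHS]flatmx0.
move=> [P [P' [Q [Q' [S [PP' QQ' ->]]]]]].
case: (IHn S) => [[y [Sy yS]] | [r [ltrn [c [s [q [t [-> tc1 qs1]]]]]]]].
  left; exists (Q' *m (one_block_mx y *m P')).
  apply: mutually_inverse_mxM => //; apply: mutually_inverse_mxM => //.
  by split; rewrite one_block_mxM ?Sy ?yS one_block_mx1.
right; exists (1 + r)%N; split; first by rewrite ltnS.
exists (P *m one_block_mx c), (Q' *m one_block_mx s).
exists (one_block_mx q *m Q), (one_block_mx t *m P'); split.
- by rewrite -one_block_mxM !mulmxA.
- by rewrite -mulmxA (mulmxA P') PP'.2 mul1mx one_block_mxM tc1 one_block_mx1.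
- by rewrite -mulmxA (mulmxA Q) QQ'.1 mul1mx one_block_mxM qs1 one_block_mx1.
Qed.

(** * Matrices, endomorphisms and products *)

Lemma strong_inner_inverse_mx (D : unitRingType) (hD : division_ring D) n
    (x : 'M[D]_n) :
  exists y : 'M[D]_n,
    strong_inner_inverse (x : mul_monoid 'M[D]_n) (y : mul_monoid 'M[D]_n).
Proof.
elim/ltn_ind: n x => n IHn x.
have [[y [xy yx]] | ] := unit_or_rank_factorization hD x.
  by exists y; apply: strong_inner_inverse_unit.
move=> [r [ltrn [c [s [q [t [-> tc1 qs1]]]]]]].
have [z uz] := IHn r ltrn (q *m c).
exact: strong_inner_inverse_induced tc1 qs1 uz.
Qed.

Lemma strong_inner_inverse_End (D : unitRingType) (hD : division_ring D)
    (V : vectType D) (x : mul_monoid (End_ring V)) :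
  exists y : mul_monoid (End_ring V), strong_inner_inverse x y.
Proof.
(* Matrices act on row vectors from the right, so taking matrices reverses
   products. *)
pose f (g : mul_monoid (End_ring V)) : mul_monoid 'M[D]_(dim V) := f2mx g.
have [y fxy] := strong_inner_inverse_mx hD (f x).
exists (Hom y : End_ring V).
apply: (@strong_inner_inverse_anti _ _ f _ _ _ x (Hom y : End_ring V)) fxy.
- exact: val_inj.
- change (f2mx (\1%VF : 'End(V)) = f2mx (Hom (1%:M : 'M[D]_(dim V)))).
  by congr f2mx; apply/lfunP=> v; rewrite id_lfunE unlock /= mulmx1 v2rK.
- move=> g h; change (f2mx (g \o h)%VF = f2mx (Hom (f2mx h *m f2mx g))).
  congr f2mx; apply/lfunP=> v; rewrite comp_lfunE.
  by rewrite !unlock /= r2vK mulmxA.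
Qed.

Lemma prod_ringX (I : Type) (R : I -> pzRingType) (x : prod_ring R) n i :
  (x ^+ n) i = x i ^+ n.
Proof. by elim: n => // n IHn; rewrite !exprS -IHn. Qed.

Lemma strong_inner_inverse_prod (I : Type) (R : I -> pzRingType)
    (x y : mul_monoid (prod_ring R)) :
  (forall i, strong_inner_inverse (x i : mul_monoid (R i))
                                  (y i : mul_monoid (R i))) ->
  strong_inner_inverse x y.
Proof.
move=> xy a b c leab lecb; apply: functional_extensionality_dep => i.
rewrite !mul_monoidX.
by have := xy i a b c leab lecb; rewrite !mul_monoidX -!prod_ringX.
Qed.

Theorem corollary6 (D : unitRingType) (hD : division_ring D)
    (I : Type) (V : I -> vectType D)
    (x : mul_monoid (prod_ring (fun i : I => End_ring (V i)))) :
  exists y : mul_monoid (prod_ring (fun i : I => End_ring (V i))),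
    strong_inner_inverse x y.
Proof.
have xy i := cid (strong_inner_inverse_End hD (x i)).
exists (fun i => sval (xy i)).
by apply: strong_inner_inverse_prod => i; apply: (svalP (xy i)).
Qed.
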